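(* Let $k \ge 2$ be an integer and let $H$ be a hypergraph containing, among its edges, all edges of a $k$-uniform tight path $P_{2k-2,k}$ on distinct vertices $a_1, a_2, \ldots, a_{2k-2}$ (in this order). Let $\mathcal{L}_k(H)$ be the hypergraph obtained from $H$ by deleting all edges of this tight path, adding new vertices $b_1, \ldots, b_{k+1}$ not in $V(H)$, and adding all edges of the $k$-uniform tight path $P_{3k-1,k}$ on the vertices $a_1, \ldots, a_{k-1}, b_1, \ldots, b_{k+1}, a_k, \ldots, a_{2k-2}$ (in this order). Then $I(\mathcal{L}_k(H)) \simeq \Sigma^{k-1} I(H)$.
   Context: A hypergraph $H$ on a finite set $V=V(H)$ is a collection of nonempty subsets of $V$, called edges. Standing convention: every edge of $H$ is inclusion-minimal (no edge properly contains another edge) and has size at least $2$. The independence complex $I(H)$ is the simplicial complex of all subsets of $V(H)$ containing no edge of $H$. The $k$-uniform tight path $P_{n,k}$ on vertices $w_1, \ldots, w_n$ (in this order) is the hypergraph whose edges are the sets $\{w_j, w_{j+1}, \ldots, w_{j+k-1}\}$ for $1 \le j \le n-k+1$. $\Sigma^{m}$ denotes the $m$-fold iterated suspension and $\simeq$ homotopy equivalence. *)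

(* Defs.v *)
From HB Require Import structures.
From mathcomp Require Import all_boot all_order all_algebra generic_quotient.
From mathcomp Require Import boolp classical_sets functions reals topology.
From mathcomp Require Import normedtype.

Set Implicit Arguments.
Unset Strict Implicit.
Unset Printing Implicit Defensive.

Import Order.TTheory GRing.Theory Num.Theory.
Import numFieldNormedType.Exports.

Section Hypergraphs.
Local Open Scope set_scope.
Local Open Scope nat_scope.

(* A hypergraph with vertex set V is given by its set of edges; vertices lying
   in no edge are allowed. *)
Definition hypergraph_axiom (V : finType) (H : {set {set V}}) : Prop :=
  (forall e, e \in H -> 2 <= #|e|) /\
  (forall e f, e \in H -> f \in H -> e \subset f -> e = f).

Definition indep_complex (V : finType) (H : {set {set V}}) : {set {set V}} :=
  [set s : {set V} | [forall e in H, ~~ (e \subset s)]]%SET.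

(* Edges of the k-uniform tight path on the vertices of w, in the order of w:
   the windows of k consecutive entries (none when size w < k). *)
Definition tight_path (V : finType) (k : nat) (w : seq V) : {set {set V}} :=
  [set [set v in take k (drop j w)]%SET | j : 'I_((size w).+1 - k)]%SET.

(* The new vertices b_1, ..., b_(k+1) are the elements of the right summand of
   V + 'I_k.+1. *)
Definition lengthened_seq (V : finType) (k : nat) (a : seq V) :
    seq (V + 'I_k.+1) :=
  [seq @inl V 'I_k.+1 x | x <- take k.-1 a]
    ++ [seq @inr V 'I_k.+1 i | i <- enum 'I_k.+1]
    ++ [seq @inl V 'I_k.+1 x | x <- drop k.-1 a].

Definition lengthening (V : finType) (k : nat) (H : {set {set V}})
    (a : seq V) : {set {set V + 'I_k.+1}} :=
  [set inl @: (e : {set V}) | e in H :\: tight_path k a]%SET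
    :|: tight_path k (lengthened_seq k a).

End Hypergraphs.

Local Open Scope classical_set_scope.
Local Open Scope ring_scope.
Local Open Scope quotient_scope.

(* Points of the geometric realization in barycentric coordinates, with the
   topology induced by the product topology on R^V. *)
Definition realization_set (R : realType) (V : finType) (K : {set {set V}}) :
    set {ptws V -> R} :=
  [set x | [/\ forall v, 0 <= x v,
              \sum_v x v = 1
            & [set v | x v != 0]%SET \in K]].

Definition realization (R : realType) (V : finType) (K : {set {set V}}) :
    topologicalType :=
  set_type (@realization_set R V K).

Definition unit_interval (R : realType) : topologicalType :=
  set_type (`[0, 1]%classic : set R).

Section Suspension.
Variables (R : realType) (X : topologicalType).

Definition susp_rel_def : rel (X * unit_interval R) := fun p q =>
  [|| p == q,
      (set_val p.2 == 0) && (set_val q.2 == 0)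
    | (set_val p.2 == 1) && (set_val q.2 == 1)].

Lemma susp_rel_refl : reflexive susp_rel_def.
Proof. by move=> p; rewrite /susp_rel_def eqxx. Qed.

Lemma susp_rel_sym : symmetric susp_rel_def.
Proof.
move=> p q; rewrite /susp_rel_def (eq_sym p).
by congr [|| _, _ | _]; exact: andbC.
Qed.

Lemma susp_rel_trans : transitive susp_rel_def.
Proof.
move=> q p r; rewrite /susp_rel_def => /or3P[/eqP-> //|/andP[p0 q0]|/andP[p1 q1]].
  case/or3P=> [/eqP<-|/andP[_ r0]|/andP[q1 _]].
  - by rewrite p0 q0 orbT.
  - by rewrite p0 r0 orbT.
  - by move: q1; rewrite (eqP q0) eq_sym oner_eq0.
case/or3P=> [/eqP<-|/andP[q0 _]|/andP[_ r1]].
- by rewrite p1 q1 !orbT.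
- by move: q1; rewrite (eqP q0) eq_sym oner_eq0.
- by rewrite p1 r1 !orbT.
Qed.

Definition susp_rel : equiv_rel (X * unit_interval R) :=
  EquivRel susp_rel_def susp_rel_refl susp_rel_sym susp_rel_trans.

(* The unreduced suspension of a nonempty space X: X * [0, 1] with X * {0} and
   X * {1} each collapsed to a point. *)
Definition suspension : topologicalType :=
  quotient_topology {eq_quot susp_rel}.

End Suspension.

Definition iter_suspension (R : realType) (m : nat) (X : topologicalType) :
    topologicalType :=
  iter m (@suspension R) X.

Definition homotopic (R : realType) (X Y : topologicalType) (f g : X -> Y) :
    Prop :=
  exists h : X * unit_interval R -> Y,
    [/\ continuous h,
        forall x t, set_val t = 0 -> h (x, t) = f x
      & forall x t, set_val t = 1 -> h (x, t) = g x].

Definition homotopy_equivalent (R : realType) (X Y : topologicalType) : Prop :=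
  exists (f : X -> Y) (g : Y -> X),
    [/\ continuous f, continuous g,
        homotopic R (g \o f) id & homotopic R (f \o g) id].

(* Main.v *)
Require Import Defs.
From mathcomp Require Import all_boot all_order all_algebra reals topology.
From mathcomp Require Import generic_quotient boolp classical_sets functions.
From mathcomp Require Import normedtype lra zify.

(** If the link of a face [sigma] of a complex [K] is a cone with apex [v], then
    deleting all faces containing [sigma] does not change the homotopy type: the
    common weight of [sigma] is pushed to [v]. For independence complexes, an edge
    [sigma] may be added or removed as soon as, for every edge [e] containing [v],
    the set [e - v + sigma] contains an edge other than [sigma].

    For the lengthened hypergraph this allows one to add back the edges of the
    short tight path, with apex one of the [b_i]; then to remove the windows
    meeting both the [a_i] and the [b_i], first those on the left, with apex
    [b_(k+1)], and then those on the right, with apex [b_1]; and finally to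
    delete the vertex [b_(k+1)], with apex [b_1]. What remains is the join of
    [I(H)] with the boundary of the simplex on [b_1, ..., b_k], and enlarging
    that simplex by one vertex suspends the join. *)

Import Order.TTheory GRing.Theory Num.Theory.
Import numFieldNormedType.Exports.

Set Implicit Arguments.
Unset Strict Implicit.
Unset Printing Implicit Defensive.

(** * Homotopies, homeomorphisms and suspensions *)

Section Topology.
Local Open Scope classical_set_scope.
Local Open Scope ring_scope.
Local Open Scope quotient_scope.

(** * Points of the unit interval *)

Section UnitInterval.
Variable R : realType.

Definition in_unit (r : R) (r01 : 0 <= r <= 1) : unit_interval R :=
  exist _ r (mem_set (r01 : `[0, 1]%classic r)).

(** The retraction of the line onto the unit interval: rescaled time parameters become total
    continuous functions, with no case split on their range. *)
Definition clamp (r : R) : R := Num.max 0 (Num.min r 1).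

Lemma clamp_bounds r : 0 <= clamp r <= 1.
Proof.
rewrite /clamp minEle maxEle; case: (leP r 1) => ?; rewrite ?ler01;
  try case: (leP 0 r) => ?; lra.
Qed.

Lemma clampE r : 0 <= r <= 1 -> clamp r = r.
Proof.
rewrite /clamp minEle maxEle; case: (leP r 1) => ?; rewrite ?ler01;
  try case: (leP 0 r) => ?; lra.
Qed.

Lemma clamp_ge1 r : 1 <= r -> clamp r = 1.
Proof.
rewrite /clamp minEle maxEle; case: (leP r 1) => ?; rewrite ?ler01;
  try case: (leP 0 r) => ?; lra.
Qed.

Lemma clamp_le0 r : r <= 0 -> clamp r = 0.
Proof.
rewrite /clamp minEle maxEle; case: (leP r 1) => ?; rewrite ?ler01;
  try case: (leP 0 r) => ?; lra.
Qed.

Lemma unit_bounds (t : unit_interval R) : 0 <= set_val t <= 1.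
Proof. by have := set_valP t; rewrite /= in_itv. Qed.

Lemma unit_val_continuous : continuous (set_val : unit_interval R -> R).
Proof. exact: initial_continuous. Qed.

Lemma continuous_in_unit (T : topologicalType) (f : T -> unit_interval R) :
  continuous (fun t => set_val (f t)) -> continuous f.
Proof. exact: continuous_comp_initial. Qed.

Lemma clamp_continuous (T : topologicalType) (f : T -> R) :
  continuous f -> continuous (fun t => clamp (f t)).
Proof.
move=> cf t.
apply: (@continuous_max R T (cst 0) (fun t => Num.min (f t) 1)).
  exact: cst_continuous.
apply: (@continuous_min R T f (cst 1)); [exact: cf | exact: cst_continuous].
Qed.

Definition clamp_unit (r : R) : unit_interval R := in_unit (clamp_bounds r).

Lemma clamp_unit_le0 r : r <= 0 -> set_val (clamp_unit r) = 0.
Proof. exact: clamp_le0. Qed.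

Lemma clamp_unit_ge1 r : 1 <= r -> set_val (clamp_unit r) = 1.
Proof. exact: clamp_ge1. Qed.

Lemma clamp_unit_continuous (T : topologicalType) (f : T -> R) :
  continuous f -> continuous (fun t => clamp_unit (f t)).
Proof. by move=> cf; apply/continuous_in_unit/clamp_continuous. Qed.

End UnitInterval.

(** * Homotopy equivalence, homeomorphism and compactness *)

Section Homotopy.
Variable R : realType.

Lemma pair_continuous (T X Y : topologicalType) (f : T -> X) (g : T -> Y) :
  continuous f -> continuous g -> continuous (fun t => (f t, g t)).
Proof. by move=> cf cg t; exact: (cvg_pair (cf t) (cg t)). Qed.

Lemma continuous_compT (X Y Z : topologicalType) (f : X -> Y) (g : Y -> Z) :
  continuous f -> continuous g -> continuous (g \o f).
Proof. by move=> cf cg x; exact: (continuous_comp (cf x) (cg (f x))). Qed.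

Lemma fst_continuous (X Y : topologicalType) : continuous (@fst X Y).
Proof. by move=> x; exact: cvg_fst. Qed.

Lemma snd_continuous (X Y : topologicalType) : continuous (@snd X Y).
Proof. by move=> x; exact: cvg_snd. Qed.

Lemma homotopic_refl (X Y : topologicalType) (f : X -> Y) :
  continuous f -> homotopic R f f.
Proof.
move=> cf; exists (fun p => f p.1); split=> //.
by apply: (@continuous_compT _ _ _ fst f) => //; exact: fst_continuous.
Qed.

Lemma homotopic_comp (X X' Y Y' : topologicalType) (f g : X -> Y)
    (a : X' -> X) (b : Y -> Y') :
  continuous a -> continuous b -> homotopic R f g ->
  homotopic R (b \o f \o a) (b \o g \o a).
Proof.
move=> ca cb [h [ch h0 h1]].
exists (fun p => b (h (a p.1, p.2))); split; last first.
- by move=> x t t1 /=; rewrite h1.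
- by move=> x t t0 /=; rewrite h0.
apply: (@continuous_compT _ _ _ (fun p => h (a p.1, p.2)) b) => //.
apply: (@continuous_compT _ _ _ (fun p => (a p.1, p.2)) h) => //.
apply: pair_continuous; last exact: snd_continuous.
by apply: (@continuous_compT _ _ _ fst a) => //; exact: fst_continuous.
Qed.

(** Both homotopies run at double speed, with the time clamped, so each formula is continuous
    everywhere. They agree at time 1/2 and are glued along two closed halves. *)
Lemma homotopic_trans (X Y : topologicalType) (f g h : X -> Y) :
  homotopic R f g -> homotopic R g h -> homotopic R f h.
Proof.
move=> [F [cF F0 F1]] [G [cG G0 G1]].
pose s (p : X * unit_interval R) : R := set_val p.2.
have cs : continuous s.
  apply: (@continuous_compT _ _ _ snd (@set_val _ _)).
    exact: snd_continuous.
  exact: unit_val_continuous.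
pose F' p := F (p.1, clamp_unit (2 * s p)).
pose G' p := G (p.1, clamp_unit (2 * s p - 1)).
have c2 : continuous (fun p => 2 * s p).
  by move=> p; apply: cvgM; [exact: cvg_cst | exact: cs].
have cF' : continuous F'.
  apply: (@continuous_compT _ _ _
    (fun p => (p.1, clamp_unit (2 * s p))) F) => //.
  apply: pair_continuous; first exact: fst_continuous.
  exact: clamp_unit_continuous.
have cG' : continuous G'.
  apply: (@continuous_compT _ _ _
    (fun p => (p.1, clamp_unit (2 * s p - 1))) G) => //.
  apply: pair_continuous; first exact: fst_continuous.
  apply: clamp_unit_continuous => p.
  by apply: cvgB; [exact: c2 | exact: cvg_cst].
pose A := [set p | s p <= 2^-1]; pose B := [set p | 2^-1 <= s p].
have cA : closed A.
  exact: (@closed_comp _ _ s [set r | r <= 2^-1] (fun x _ => cs x)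
    (@closed_le _ _)).
have cB : closed B.
  exact: (@closed_comp _ _ s [set r | 2^-1 <= r] (fun x _ => cs x)
    (@closed_ge _ _)).
pose H p := if s p <= 2^-1 then F' p else G' p.
have HA : {in A, F' =1 H} by move=> p; rewrite inE /A /H /= => ->.
have HB : {in B, G' =1 H}.
  move=> p; rewrite inE /B /H /= => ps; case: leP => // sp.
  have {ps}sp : s p = 2^-1 by apply/le_anti/andP.
  rewrite /F' /G' sp divff ?pnatr_eq0 // subrr.
  rewrite (G0 _ _ (clamp_unit_le0 (lexx _))).
  by rewrite (F1 _ _ (clamp_unit_ge1 (lexx _))).
exists H; split.
- have : {within A `|` B, continuous H}.
    apply: withinU_continuous => //.
      apply: (subspace_eq_continuous HA); exact: continuous_subspaceT.
    apply: (subspace_eq_continuous HB); exact: continuous_subspaceT.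
  suff -> : A `|` B = [set: X * unit_interval R].
    by move=> cH; apply/continuous_subspace_setT; exact: cH.
  apply/seteqP; split=> // p _.
  case: (leP (s p) 2^-1) => [sp|/ltW sp]; first by left; exact: sp.
  by right; exact: sp.
- move=> x t t0; rewrite /H /s /= t0 invr_ge0 ler0n.
  by apply: F0; apply: clamp_unit_le0; rewrite /s t0 mulr0.
- move=> x t t1; rewrite /H /s /= t1.
  case: leP => [|_]; first by move=> ?; exfalso; lra.
  by apply: G1; apply: clamp_unit_ge1; rewrite /s t1; lra.
Qed.

Lemma homotopy_equivalent_sym (X Y : topologicalType) :
  homotopy_equivalent R X Y -> homotopy_equivalent R Y X.
Proof. by move=> [f [g [? ? ? ?]]]; exists g, f. Qed.

Lemma homotopy_equivalent_trans (X Y Z : topologicalType) :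
  homotopy_equivalent R X Y -> homotopy_equivalent R Y Z ->
  homotopy_equivalent R X Z.
Proof.
move=> [f [g [cf cg gf fg]]] [f' [g' [cf' cg' gf' fg']]].
exists (f' \o f), (g \o g'); split; try exact: continuous_compT.
- exact: (homotopic_trans (homotopic_comp cf cg gf') gf).
- exact: (homotopic_trans (homotopic_comp cg' cf' fg) fg').
Qed.

Definition homeomorphic (X Y : topologicalType) : Prop :=
  exists (f : X -> Y) (g : Y -> X),
    [/\ continuous f, continuous g, cancel f g & cancel g f].

Lemma homeomorphic_sym (X Y : topologicalType) :
  homeomorphic X Y -> homeomorphic Y X.
Proof. by move=> [f [g [? ? ? ?]]]; exists g, f. Qed.

Lemma homeomorphic_trans (X Y Z : topologicalType) :
  homeomorphic X Y -> homeomorphic Y Z -> homeomorphic X Z.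
Proof.
move=> [f [g [cf cg fK gK]]] [f' [g' [cf' cg' fK' gK']]].
exists (f' \o f), (g \o g'); split; try exact: continuous_compT.
- exact: can_comp.
- exact: can_comp.
Qed.

Lemma homeomorphic_homotopy_equivalent (X Y : topologicalType) :
  homeomorphic X Y -> homotopy_equivalent R X Y.
Proof.
move=> [f [g [cf cg fK gK]]]; exists f, g; split=> //.
- have -> : g \o f = id by apply/funext.
  by apply: homotopic_refl => x.
- have -> : f \o g = id by apply/funext.
  by apply: homotopic_refl => x.
Qed.

(** The preimage of a closed set under the inverse is its image under [f], which is compact and
    hence closed. *)
Lemma bij_compact_hausdorff (X Y : topologicalType) (f : X -> Y) :
  compact [set: X] -> hausdorff_space Y -> continuous f -> bijective f ->
  homeomorphic X Y.
Proof.
move=> cX hY cf [g fK gK]; exists f, g; split=> //.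
apply: (@continuous_closedP _ _ g).2 => A cA.
suff -> : g @^-1` A = f @` A.
  apply: compact_closed => //; apply: continuous_compact.
    exact: continuous_subspaceT.
  exact: (subclosed_compact cA cX).
apply/seteqP; split=> [y Ay | _ [x Ax <-]]; last by rewrite /= fK.
by exists (g y) => //; exact: gK.
Qed.

(** A filter on the subtype is pushed forward to [T]; its cluster point in [A] lifts back, since
    open sets of the subtype are traces of open sets of [T]. *)
Lemma compact_set_type (T : topologicalType) (A : set T) :
  compact A -> compact [set: set_type A].
Proof.
move=> cA F FF _; have [|p [Ap clp]] := cA (set_val @ F) _.
  by apply: (@filterE _ F) => x; exact: set_valP.
exists (exist _ p (mem_set Ap)); split=> // U B FU.
rewrite nbhsE => -[_ [[C oC <-] Cp] CB].
have nC := open_nbhs_nbhs (conj oC Cp).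
have [|_ [[x Ux <-] Cx]] := clp (set_val @` U) C _ nC.
  by apply: (@filterS _ F _ U) => // x Ux; exists x.
by exists x; split=> //; exact: CB.
Qed.

(** * Maps out of a suspension *)

Section SuspensionMaps.
Variable X : topologicalType.
Implicit Types p q : X * unit_interval R.

Lemma suspension_piP p q :
  \pi_(suspension R X) p = \pi_(suspension R X) q <-> susp_rel_def p q.
Proof.
by have e := @eqmodP _ (susp_rel R X) p q; split=> [/e | /e].
Qed.

(** Evaluation at a chosen representative; this is the induced map as soon as [g] respects the
    relation. *)
Definition suspension_lift (Z : Type) (g : X * unit_interval R -> Z) :
    suspension R X -> Z :=
  g \o repr.

Lemma suspension_lift_pi (Z : Type) (g : X * unit_interval R -> Z) p :
  (forall p q, susp_rel_def p q -> g p = g q) ->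
  suspension_lift g (\pi_(suspension R X) p) = g p.
Proof.
move=> gP; apply: gP; apply/suspension_piP; exact: reprK.
Qed.

Lemma suspension_lift_continuous (Z : topologicalType)
    (g : X * unit_interval R -> Z) :
  (forall p q, susp_rel_def p q -> g p = g q) -> continuous g ->
  continuous (suspension_lift g).
Proof.
move=> gP cg; apply/quotient_continuous.
suff -> : suspension_lift g \o \pi_(suspension R X) = g by [].
by apply/funext => p; exact: suspension_lift_pi.
Qed.

Lemma suspension_compact :
  compact [set: X] -> compact [set: suspension R X].
Proof.
move=> cX.
have -> : [set: suspension R X] =
    \pi_(suspension R X) @` ([set: X] `*` [set: unit_interval R]).
  apply/seteqP; split=> // q _; exists (repr q) => //; exact: reprK.
apply: continuous_compact.
  by apply: continuous_subspaceT; exact: pi_continuous.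
apply: compact_setX => //; exact/compact_set_type/segment_compact.
Qed.

End SuspensionMaps.

Definition suspension_map (X Y : topologicalType) (f : X -> Y) :
    suspension R X -> suspension R Y :=
  suspension_lift (fun p => \pi_(suspension R Y) (f p.1, p.2)).

Lemma susp_rel_map (X Y : topologicalType) (f : X -> Y)
    (p q : X * unit_interval R) :
  susp_rel_def p q -> \pi_(suspension R Y) (f p.1, p.2) =
                      \pi_(suspension R Y) (f q.1, q.2).
Proof.
move=> pq; apply/suspension_piP; rewrite /susp_rel_def /=.
by case/or3P: pq => [/eqP->|->|->]; rewrite ?eqxx ?orbT.
Qed.

Lemma suspension_map_continuous (X Y : topologicalType) (f : X -> Y) :
  continuous f -> continuous (suspension_map f).
Proof.
move=> cf; apply: suspension_lift_continuous; first exact: susp_rel_map.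
apply: (@continuous_compT _ _ _ (fun p => (f p.1, p.2)) (\pi_(suspension R Y))).
  apply: pair_continuous; last exact: snd_continuous.
  by apply: (@continuous_compT _ _ _ fst f) => //; exact: fst_continuous.
exact: pi_continuous.
Qed.

Lemma suspension_mapK (X Y : topologicalType) (f : X -> Y) (g : Y -> X) :
  cancel f g -> cancel (suspension_map f) (suspension_map g).
Proof.
move=> fK q; have [p ->] : exists p, q = \pi_(suspension R X) p.
  by exists (repr q); rewrite reprK.
rewrite /suspension_map suspension_lift_pi; last exact: susp_rel_map.
rewrite suspension_lift_pi; last exact: susp_rel_map.
by rewrite /= fK -surjective_pairing.
Qed.

Lemma suspension_homeomorphic (X Y : topologicalType) :
  homeomorphic X Y -> homeomorphic (suspension R X) (suspension R Y).
Proof.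
move=> [f [g [cf cg fK gK]]]; exists (suspension_map f), (suspension_map g).
by split; do ?[exact: suspension_map_continuous | exact: suspension_mapK].
Qed.

End Homotopy.

End Topology.

(** * Geometric realizations *)

Section Realizations.
Local Open Scope classical_set_scope.
Local Open Scope ring_scope.
Local Open Scope quotient_scope.

Definition down_closed (V : finType) (K : {set {set V}}) : Prop :=
  forall s t : {set V}, s \subset t -> t \in K -> s \in K.

(** * Barycentric coordinates, compactness and contiguous maps *)

Section Realization.
Variables (R : realType) (V : finType) (K : {set {set V}}).
Implicit Types (x : realization R K) (v : V).

Definition bary x : V -> R := set_val x.

Definition supp (w : V -> R) : {set V} := [set v | w v != 0]%SET.

Lemma bary_ge0 x v : 0 <= bary x v.
Proof. by have [x0 _ _] := set_valP x; exact: x0. Qed.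

Lemma bary_sum x : \sum_v bary x v = 1.
Proof. by have [_ x1 _] := set_valP x. Qed.

Lemma bary_supp x : supp (bary x) \in K.
Proof. by have [_ _ xK] := set_valP x. Qed.

Lemma bary_le1 x v : bary x v <= 1.
Proof.
rewrite -(bary_sum x) (bigD1 v) //= lerDl sumr_ge0 // => u _.
exact: bary_ge0.
Qed.

Definition realization_point (w : V -> R) (wK : realization_set K w) :
    realization R K :=
  exist _ w (mem_set wK).

Lemma bary_inj x y : bary x =1 bary y -> x = y.
Proof. by move=> /funext xy; exact: val_inj. Qed.

Lemma vertex_point v : [set v]%SET \in K -> realization R K.
Proof.
move=> vK; apply: (@realization_point (fun u => (u == v)%:R)); split=> [u||].
- exact: ler0n.
- by rewrite -natr_sum (bigD1 v) //= eqxx big1 // => u /negPf->.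
rewrite (_ : finset _ = [set v]%SET) //.
by apply/setP => u; rewrite !inE pnatr_eq0 eqb0 negbK.
Qed.

Lemma ptws_eval_continuous v : continuous (fun w : {ptws V -> R} => w v).
Proof. exact: (@proj_continuous V (fun=> R)). Qed.

Lemma bary_continuous v : continuous (fun x => bary x v).
Proof.
apply: (@continuous_compT _ _ _ (@set_val _ _) (fun w : {ptws V -> R} => w v)).
  exact: initial_continuous.
exact: ptws_eval_continuous.
Qed.

Lemma realization_continuous (T : topologicalType) (f : T -> realization R K) :
  (forall v, continuous (fun t => bary (f t) v)) -> continuous f.
Proof.
move=> cf; apply: continuous_comp_initial => t.
apply/cvg_sup => v.
apply: (@continuous_comp_initial _ _ _ (fun w : V -> R => w v)
  (fun t => set_val (f t))).
exact: cf.
Qed.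

Lemma realization_hausdorff : hausdorff_space (realization R K).
Proof.
move=> x y clxy; apply: bary_inj => v.
apply: (@norm_hausdorff _ R) => A B nA nB.
have [z [Az Bz]] := clxy _ _ (bary_continuous nA) (bary_continuous nB).
by exists (bary z v).
Qed.

Lemma sum_ptws_continuous : continuous (fun w : {ptws V -> R} => \sum_v w v).
Proof.
apply: continuous_big => [|v _]; last exact: ptws_eval_continuous.
exact: add_continuous.
Qed.

Lemma prod_ptws_continuous (s : {set V}) :
  continuous (fun w : {ptws V -> R} => \prod_(v in s) w v).
Proof.
apply: continuous_big => [|v _]; last exact: ptws_eval_continuous.
exact: mul_continuous.
Qed.

(* The support of [w] is a face iff the product of the coordinates over every
   non-face vanishes: a closed condition. *)
Lemma realization_set_closed :
  down_closed K -> closed (@realization_set R V K).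
Proof.
move=> dK.
have -> : @realization_set R V K =
   (\bigcap_(v in [set: V]) [set w : {ptws V -> R} | 0 <= w v]) `&`
   ([set w : {ptws V -> R} | \sum_v w v = 1] `&`
    \bigcap_(s in [set s | s \notin K])
       [set w : {ptws V -> R} | \prod_(v in s) w v = 0]).
  apply/seteqP; split=> [w [w0 w1 wK] | w [w0 [w1 wK]]].
    split=> [v _ | ]; first exact: w0.
    split=> // s /= sK; apply/eqP; apply: contraNT sK => /prodf_neq0 sw.
    by apply: dK wK; apply/fintype.subsetP => v vs; rewrite inE sw.
  split=> // [v | ]; first exact: w0.
  apply: contrapT => /negP /wK /eqP /prodf_eq0 [v].
  by rewrite inE => /negP wv /eqP w00; apply: wv; apply/eqP.
apply: closedI.
  apply: closed_bigI => v _.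
  apply: (@closed_comp _ _ (fun w : {ptws V -> R} => w v) [set r | 0 <= r]).
    by move=> w _; exact: ptws_eval_continuous.
  exact: closed_ge.
apply: closedI.
  apply: (@closed_comp _ _ (fun w : {ptws V -> R} => \sum_v w v)
    [set r | r = 1]).
    by move=> w _; exact: sum_ptws_continuous.
  exact: closed_eq.
apply: closed_bigI => s _.
apply: (@closed_comp _ _ (fun w : {ptws V -> R} => \prod_(v in s) w v)
  [set r | r = 0]).
  by move=> w _; exact: prod_ptws_continuous.
exact: closed_eq.
Qed.

(** The realization is a closed subset of a cube, which is compact by Tychonoff. *)
Lemma realization_compact : down_closed K -> compact [set: realization R K].
Proof.
move=> dK; apply: compact_set_type.
apply: (subclosed_compact (realization_set_closed dK)
  (@tychonoff V (fun=> R) (fun=> `[0, 1]%classic) _)).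
  by move=> v; exact: segment_compact.
move=> w wK v; have := bary_ge0 (realization_point wK) v.
by have := bary_le1 (realization_point wK) v; rewrite /= in_itv /= => -> ->.
Qed.

(** The straight-line homotopy works: the support of a convex combination lies in the union of the
    two supports, which is a face. *)
Lemma contiguous_homotopic (X : topologicalType) (f g : X -> realization R K) :
  down_closed K -> continuous f -> continuous g ->
  (forall p : X, supp (bary (f p)) :|: supp (bary (g p)) \in K) ->
  homotopic R f g.
Proof.
move=> dK cf cg fgK.
pose w (p : X * unit_interval R) v :=
  (1 - set_val p.2) * bary (f p.1) v + set_val p.2 * bary (g p.1) v.
have wK p : realization_set K (w p).
  have /andP[t0 t1] := unit_bounds p.2; split=> [v||].
  - by rewrite addr_ge0 // mulr_ge0 ?bary_ge0 // subr_ge0.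
  - by rewrite big_split /= -!mulr_sumr !bary_sum !mulr1 subrK.
  apply: dK (fgK p.1); apply/fintype.subsetP => v; rewrite !inE /w.
  apply: contra_neqT; rewrite negb_or !negbK => /andP[/eqP-> /eqP->].
  by rewrite !mulr0 addr0.
exists (fun p => realization_point (wK p)); split.
- apply: realization_continuous => v.
  have ct : continuous (fun p : X * unit_interval R => set_val p.2).
    apply: (@continuous_compT _ _ _ snd (@set_val _ _)).
      exact: snd_continuous.
    exact: unit_val_continuous.
  have cc (h : X -> realization R K) : continuous h ->
      continuous (fun p : X * unit_interval R => bary (h p.1) v).
    move=> ch; apply: (@continuous_compT _ _ _ fst (fun q => bary (h q) v)).
      exact: fst_continuous.
    apply: (@continuous_compT _ _ _ h (fun x => bary x v)) => //.
    exact: bary_continuous.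
  move=> p; apply: cvgD; apply: cvgM; try exact: ct; try exact: cc.
  by apply: cvgB; [exact: cvg_cst | exact: ct].
- move=> p t t0; apply: bary_inj => v.
  by rewrite [LHS]/(w (p, t) v) /w t0 subr0 mul1r mul0r addr0.
- move=> p t t1; apply: bary_inj => v.
  by rewrite [LHS]/(w (p, t) v) /w t1 subrr mul1r mul0r add0r.
Qed.

End Realization.

(** * The common weight of a set of vertices *)

Section MinWeight.
Variables (R : realType) (V : finType) (K : {set {set V}}) (sigma : {set V}).
Implicit Type x : realization R K.

(** The default 1 bounds every barycentric coordinate, so it does not affect the minimum over a
    nonempty [sigma]. *)
Definition min_weight (w : V -> R) : R := \big[Num.min/1]_(u in sigma) w u.

Lemma min_weight_attained x :
  sigma != finset.set0 ->
  exists2 u, u \in sigma & min_weight (bary x) = bary x u.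
Proof.
move=> /set0Pn[u0 u0s].
rewrite /min_weight (@bigmin_eq_arg _ _ _ _ u0) //; last first.
  by move=> u _; exact: bary_le1.
by case: arg_minP => // u us _; exists u.
Qed.

Lemma min_weight_ge0 x : 0 <= min_weight (bary x).
Proof. by apply: le_bigmin => // u _; exact: bary_ge0. Qed.

Lemma min_weight_le x u : u \in sigma -> min_weight (bary x) <= bary x u.
Proof. by move=> us; apply: bigmin_le_cond. Qed.

Lemma min_weight_continuous :
  continuous (fun x : realization R K => min_weight (bary x)).
Proof.
apply: continuous_big => [p|u _]; last exact: bary_continuous.
apply: (@continuous_min R _ fst snd); first exact: fst_continuous.
exact: snd_continuous.
Qed.

End MinWeight.

(** * Removing the faces that contain a simplex whose link is a cone *)

Section ConeLink.
Variables (R : realType) (V : finType) (K : {set {set V}}).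
Variables (sigma : {set V}) (v : V).
Hypotheses (dK : down_closed K) (sigma0 : sigma != finset.set0).
Hypotheses (vsigma : v \notin sigma)
  (link_cone : forall s, s \in K -> sigma \subset s -> v |: s \in K).

Definition faces_avoiding : {set {set V}} :=
  [set s in K | ~~ (sigma \subset s)]%SET.

Let L := faces_avoiding.

Let mu (w : V -> R) : R := min_weight sigma w.

Let mu_attained (x : realization R K) :
  exists2 u, u \in sigma & mu (bary x) = bary x u.
Proof. exact: min_weight_attained. Qed.

Let mu_ge0 (x : realization R K) : 0 <= mu (bary x).
Proof. exact: min_weight_ge0. Qed.

Let mu_le (x : realization R K) u : u \in sigma -> mu (bary x) <= bary x u.
Proof. exact: min_weight_le. Qed.

(** Every vertex of [sigma] loses [mu w] and [v] receives all of it, so the total weight is kept. *)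
Let push (w : V -> R) (u : V) : R :=
  w u + mu w * ((#|sigma| * (u == v))%:R - (u \in sigma)%:R).

(** Either [mu] vanishes and nothing moves, or all of [sigma] has positive weight and [v] is the
    only vertex that can enter the support. *)
Let push_supp (x : realization R K) :
  (supp (push (bary x)) \subset supp (bary x)) \/
  (sigma \subset supp (bary x) /\
   supp (push (bary x)) \subset v |: supp (bary x)).
Proof.
have [m0|m_neq0] := eqVneq (mu (bary x)) 0.
  left; apply/fintype.subsetP => u; rewrite !inE /push m0 mul0r addr0.
  by [].
right; have m_gt0 : 0 < mu (bary x) by rewrite lt_def m_neq0 mu_ge0.
split; apply/fintype.subsetP => u.
  by move=> us; rewrite inE gt_eqF // (lt_le_trans m_gt0) // mu_le.
rewrite !inE /push; case: (eqVneq u v) => //= _; apply: contraNN => /eqP x0.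
rewrite x0 muln0 sub0r add0r; case us: (u \in sigma); last first.
  by rewrite oppr0 mulr0.
by have := lt_le_trans m_gt0 (@mu_le x u us); rewrite x0 ltxx.
Qed.

(** Used twice: it keeps the pushed point inside [K], and it makes pushing contiguous to the
    identity. *)
Let push_face (x : realization R K) :
  supp (push (bary x)) :|: supp (bary x) \in K.
Proof.
have [sub|[ssub sub]] := push_supp x.
  by rewrite (finset.setUidPr sub) bary_supp.
apply: dK (link_cone (bary_supp x) ssub).
by rewrite finset.subUset sub finset.subsetUr.
Qed.

Let push_realization (x : realization R K) :
  realization_set L (push (bary x)).
Proof.
split=> [u||].
- rewrite /push; case us: (u \in sigma).
    have /negPf-> : u != v by apply: contraNneq vsigma => <-.
    by rewrite muln0 sub0r mulrN mulr1 subr_ge0 mu_le.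
  by rewrite subr0 addr_ge0 ?bary_ge0 // mulr_ge0 ?mu_ge0.
- rewrite /push big_split /= bary_sum -mulr_sumr big_split /= sumrN.
  rewrite -!natr_sum -big_distrr /= (bigD1 v) //= eqxx big1 ?addn0; last first.
    by move=> u /negPf->.
  by rewrite muln1 -big_mkcond sum1_card subrr mulr0 addr0.
- rewrite inE (dK _ (push_face x)) ?finset.subsetUl //=.
  (* A vertex of [sigma] of least weight drops to weight 0, so the new support no longer contains
     [sigma]. *)
  have [u us mu_u] := mu_attained x.
  apply/fintype.subsetPn; exists u => //; rewrite inE negbK /push mu_u us.
  have /negPf-> : u != v by apply: contraNneq vsigma => <-.
  by rewrite muln0 sub0r mulrN mulr1 subrr.
Qed.

Let push_id (x : realization R K) :
  supp (bary x) \in L -> push (bary x) =1 bary x.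
Proof.
rewrite inE => /andP[_ /fintype.subsetPn[u us]]; rewrite inE negbK => /eqP xu.
move=> t; rewrite /push.
have -> : mu (bary x) = 0 by apply/le_anti; rewrite mu_ge0 -xu mu_le.
by rewrite mul0r addr0.
Qed.

(** Pushing retracts the realization of [K] onto that of [L]: it fixes points supported in [L],
    where [mu] is 0, and followed by the inclusion it is contiguous to the identity. *)
Lemma cone_link_equivalent :
  homotopy_equivalent R (realization R K) (realization R L).
Proof.
have incl (y : realization R L) : realization_set K (bary y).
  by have [y0 y1] := set_valP y; rewrite inE => /andP[yK _]; split.
pose i y := realization_point (incl y).
pose r x := realization_point (push_realization x).
have cr : continuous r.
  apply: realization_continuous => u x.
  exact: (cvgD (@bary_continuous R V K u x)
    (cvgM (@min_weight_continuous R V K sigma x) (@cvg_cst _ _ _ _ _))).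
have ci : continuous i.
  by apply: realization_continuous => u; exact: (@bary_continuous R V L u).
exists r, i; split=> //.
- apply: contiguous_homotopic => //; [exact: continuous_compT | by move=> x].
- have -> : r \o i = id.
    apply/funext => y; apply: bary_inj => u.
    exact: (@push_id (i y) (bary_supp y)).
  by apply: homotopic_refl => x.
Qed.

End ConeLink.

(** * A complex as the suspension of its equator *)

Section SuspensionRealization.
Variables (R : realType) (V : finType) (K : {set {set V}}).
Variables (b : V) (B : {set V}).

Definition equator : {set {set V}} :=
  [set s in K | (b \notin s) && ~~ (B \subset s)]%SET.

Hypotheses (dK : down_closed K) (B0 : B != finset.set0) (bB : b \notin B).
Hypothesis no_join : b |: B \notin K.
Hypothesis north : forall s, s \in equator -> b |: s \in K.
Hypothesis south : forall s, s \in equator -> B :|: s \in K.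
Hypothesis x0 : realization R equator.

Let c : R := #|B|%:R.

Let c_gt0 : 0 < c.
Proof. by rewrite ltr0n card_gt0. Qed.

Let up (t : R) : R := clamp (2 * t - 1).
Let down (t : R) : R := clamp (1 - 2 * t).

(** Time 1/2 gives the equator; later times move towards [b], earlier ones towards the barycenter of
    [B]. At most one of [up] and [down] is nonzero. *)
Let blend (p : realization R equator * unit_interval R) (u : V) : R :=
  (1 - up (set_val p.2) - down (set_val p.2)) * bary p.1 u +
  up (set_val p.2) * (u == b)%:R + down (set_val p.2) / c * (u \in B)%:R.

Let up_down_cases (t : R) : 0 <= t <= 1 ->
  [/\ 2 * t <= 1, up t = 0 & down t = 1 - 2 * t] \/
  [/\ 1 <= 2 * t, up t = 2 * t - 1 & down t = 0].
Proof.
move=> /andP[t0 t1]; have [t2|t2] := leP (2 * t) 1.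
  by left; split=> //; [apply: clamp_le0 | apply: clampE]; lra.
by right; split; [exact: ltW | apply: clampE | apply: clamp_le0]; lra.
Qed.

Let equator_b (x : realization R equator) : bary x b = 0.
Proof.
have := bary_supp x; rewrite inE => /and3P[_ + _].
by rewrite inE negbK => /eqP.
Qed.

Let equator_B (x : realization R equator) :
  exists2 u, u \in B & bary x u = 0.
Proof.
have := bary_supp x; rewrite inE => /and3P[_ _ /fintype.subsetPn[u uB]].
by rewrite inE negbK => /eqP; exists u.
Qed.

Let blend_realization p : realization_set K (blend p).
Proof.
case: p => x t; rewrite /blend /=; have t01 := unit_bounds t.
have xE := bary_supp x.
have xK : supp (bary x) \in K by move: xE; rewrite inE => /andP[].
split=> [u||].
- have := bary_ge0 x u; have := ltW c_gt0.
  have [[t2 -> ->]|[t2 -> ->]] := up_down_cases t01 => c0 xu0.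
    rewrite mul0r addr0 addr_ge0 ?mulr_ge0 ?invr_ge0 ?ler0n //; lra.
  rewrite mul0r mul0r addr0 addr_ge0 ?mulr_ge0 ?ler0n //; lra.
- rewrite !big_split /= -!mulr_sumr bary_sum mulr1 -!natr_sum.
  rewrite (bigD1 b) //= eqxx big1 => [|u /negPf-> //]; rewrite addn0 mulr1.
  rewrite -big_mkcond sum1_card mulfVK ?gt_eqF //; lra.
- have [[_ -> _]|[_ _ ->]] := up_down_cases t01.
    apply: dK (south xE); apply/fintype.subsetP => u; rewrite !inE.
    case: (u \in B) => //=; rewrite mulr0 mul0r !addr0.
    by apply: contraNN => /eqP->; rewrite mulr0.
  apply: dK (north xE); apply/fintype.subsetP => u; rewrite !inE.
  case: (u == b) => //=; rewrite mulr0 !mul0r !addr0.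
  by apply: contraNN => /eqP->; rewrite mulr0.
Qed.

Let join (p : realization R equator * unit_interval R) : realization R K :=
  realization_point (blend_realization p).

Let join_compat p q : susp_rel_def p q -> join p = join q.
Proof.
move=> pq; apply: bary_inj => u; rewrite [LHS]/(blend p u) [RHS]/(blend q u).
case/or3P: pq => [/eqP-> //|/andP[/eqP p0 /eqP q0]|/andP[/eqP p1 /eqP q1]].
  have u0 : up 0 = 0 by apply: clamp_le0; lra.
  have d0 : down 0 = 1 by apply: clamp_ge1; lra.
  by rewrite /blend p0 q0 u0 d0 subr0 subrr !mul0r.
have u1 : up 1 = 1 by apply: clamp_ge1; lra.
have d1 : down 1 = 0 by apply: clamp_le0; lra.
by rewrite /blend p1 q1 u1 d1 subr0 subrr !mul0r.
Qed.

Let join_continuous : continuous join.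
Proof.
apply: realization_continuous => u p.
have ct : continuous
    (fun p : realization R equator * unit_interval R => set_val p.2).
  apply: (@continuous_compT _ _ _ snd (@set_val _ _)).
    exact: snd_continuous.
  exact: unit_val_continuous.
have cu : continuous
    (fun p : realization R equator * unit_interval R => up (set_val p.2)).
  apply: clamp_continuous => q; apply: cvgB; last exact: cvg_cst.
  by apply: cvgM; [exact: cvg_cst | exact: ct].
have cd : continuous
    (fun p : realization R equator * unit_interval R => down (set_val p.2)).
  apply: clamp_continuous => q; apply: cvgB; first exact: cvg_cst.
  by apply: cvgM; [exact: cvg_cst | exact: ct].
have cx : continuous
    (fun p : realization R equator * unit_interval R => bary p.1 u).
  apply: (@continuous_compT _ _ _ fst (fun x => bary x u)).
    exact: fst_continuous.
  exact: bary_continuous.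
have cb : continuous (fun p => blend p u).
  move=> q; apply: cvgD; first apply: cvgD.
  - apply: cvgM; last exact: cx.
    by apply: cvgB; last exact: cd; apply: cvgB; [exact: cvg_cst | exact: cu].
  - by apply: cvgM; [exact: cu | exact: cvg_cst].
  - apply: cvgM; last exact: cvg_cst.
    by apply: cvgM; [exact: cd | exact: cvg_cst].
exact: (cb p).
Qed.

(** The coordinate at [b] recovers [up]. At a vertex of [B] where one equator point vanishes, its
    blend has weight exactly [down / c], while the other blend has at least its own [down / c];
    comparing both ways recovers [down], hence the time. *)
Let join_inj p q : join p = join q -> susp_rel_def p q.
Proof.
case: p q => [x t] [y s] e.
have {}e u : blend (x, t) u = blend (y, s) u.
  by rewrite -[LHS]/(bary (join (x, t)) u) e.
have t01 := unit_bounds t; have s01 := unit_bounds s.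
have eup : up (set_val t) = up (set_val s).
  have := e b; rewrite /blend /= !equator_b eqxx (negPf bB).
  by rewrite !mulr0 !mulr1 !add0r !addr0.
have down_le (x1 y1 : realization R equator) (t1 s1 : unit_interval R) :
    (forall u, blend (x1, t1) u = blend (y1, s1) u) ->
    down (set_val s1) <= down (set_val t1).
  move=> e1; have [u uB xu] := equator_B x1; have := e1 u.
  have ub : u != b by apply: contraNneq bB => <-.
  rewrite /blend /= xu uB (negPf ub) !mulr0 !addr0 add0r !mulr1 => e2.
  rewrite -(@ler_pM2r _ c^-1) ?invr_gt0 // e2 lerDr mulr_ge0 ?bary_ge0 //.
  by case: (up_down_cases (unit_bounds s1)) (unit_bounds s1) => -[? -> ->]; lra.
have edown : down (set_val t) = down (set_val s).
  by apply/le_anti; rewrite (down_le y x s t) // (down_le x y t s).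
have ets : set_val t = set_val s.
  by case: (up_down_cases t01) eup edown => -[? -> ->];
    case: (up_down_cases s01) => -[? -> ->]; lra.
rewrite /susp_rel_def /= -ets !andbb.
case: (eqVneq (set_val t) 0) => [_|t0] /=; first by rewrite orbT.
case: (eqVneq (set_val t) 1) => [_|t1] /=; first by rewrite !orbT.
rewrite !orbF; apply/eqP; congr pair; last exact: val_inj.
apply: bary_inj => u; have := e u; rewrite /blend /= -eup -edown.
move=> /addIr /addIr /mulfI; apply.
(* The factor to cancel, [1 - up - down], vanishes only at times 0 and 1. *)
apply: contra_neq t0.
case: (up_down_cases t01) t1 => -[? -> ->] t1 ?; first by lra.
by case/eqP: t1; lra.
Qed.

(** The weight [n] of [b] and the common weight [m] of [B] are split off from [y]. They are not both
    positive, since [b |: B] is not a face; what remains, once normalized, is a point of the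
    equator. *)
Let join_surj (y : realization R K) : exists p, join p = y.
Proof.
pose n := bary y b; pose m := min_weight B (bary y).
have n0 : 0 <= n := bary_ge0 y b; have m0 : 0 <= m := min_weight_ge0 B y.
have nm0 : n = 0 \/ m = 0.
  have [n_eq0|n_neq0] := eqVneq n 0; first by left.
  right; apply/eqP; apply: contraNT no_join => m_neq0.
  apply: dK (bary_supp y); apply/fintype.subsetP => u; rewrite !inE.
  case/orP => [/eqP-> //|uB]; rewrite gt_eqF //.
  by rewrite (@lt_le_trans _ _ m) ?lt_def ?m_neq0 // min_weight_le.
pose rest u := bary y u - n * (u == b)%:R - m * (u \in B)%:R.
have rest_ge0 u : 0 <= rest u.
  rewrite /rest; case: eqVneq => [->|_].
    by rewrite (negPf bB) mulr1 subrr mulr0 subr0.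
  rewrite mulr0 subr0; case uB: (u \in B); last by rewrite mulr0 subr0 bary_ge0.
  by rewrite mulr1 subr_ge0 min_weight_le.
have rest_sum : \sum_u rest u = 1 - n - m * c.
  rewrite /rest !sumrB -!mulr_sumr bary_sum -!natr_sum.
  rewrite (bigD1 b) //= eqxx big1 => [|u /negPf-> //]; rewrite addn0 mulr1.
  by rewrite -big_mkcond sum1_card.
have rest_b : rest b = 0.
  by rewrite /rest eqxx (negPf bB) mulr1 subrr mulr0 subr0.
have [u0 u0B mu0] := min_weight_attained y B0.
have rest_u0 : rest u0 = 0.
  have /negPf u0b : u0 != b by apply: contraNneq bB => <-.
  by rewrite /rest u0B u0b mulr0 subr0 mulr1 -mu0 subrr.
(* As [n] or [m] vanishes, this is the time at which [up] is [n] and [down] is [m * c]. *)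
pose tau := (1 + n - m * c) / 2.
have mc0 : 0 <= m * c by rewrite mulr_ge0 // ltW.
have nmc : n + m * c <= 1.
  have : 0 <= \sum_u rest u by apply: sumr_ge0 => u _; exact: rest_ge0.
  by rewrite rest_sum; lra.
have tau01 : 0 <= tau <= 1 by rewrite /tau; lra.
have up_tau : up tau = n.
  rewrite /up /tau; case: nm0 => ->; rewrite ?mul0r;
    [rewrite clamp_le0 | rewrite clampE]; lra.
have down_tau : down tau = m * c.
  rewrite /down /tau; case: nm0 => ->; rewrite ?mul0r;
    [rewrite clampE | rewrite clamp_le0]; lra.
pose d := 1 - n - m * c.
have blendE (x : realization R equator) u :
    d * bary x u = rest u -> blend (x, in_unit tau01) u = bary y u.
  have tauE : set_val (in_unit tau01) = tau by [].
  rewrite /blend tauE up_tau down_tau mulfK ?gt_eqF //.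
  by rewrite -/d => ->; rewrite /rest; lra.
(* If nothing remains, [y] is a pole, over which any equator point lies; [x0] supplies one. *)
have [d0|d_neq0] := eqVneq d 0.
  exists (x0, in_unit tau01); apply: bary_inj => u; apply: blendE.
  rewrite d0 mul0r; apply/eqP; rewrite eq_sym; apply/eqP.
  apply: (psumr_eq0P (P := predT) (F := rest)) => //.
  by rewrite rest_sum.
have d_gt0 : 0 < d by rewrite lt_def d_neq0 /d; lra.
have xE : realization_set equator (fun u => rest u / d).
  split=> [u||].
  - by rewrite divr_ge0 // ltW.
  - by rewrite -mulr_suml rest_sum divff.
  have inv_d0 : d^-1 != 0 by rewrite invr_eq0.
  rewrite inE; apply/and3P; split.
  + apply: dK (bary_supp y); apply/fintype.subsetP => u; rewrite !inE.
    rewrite mulf_eq0 (negPf inv_d0) orbF; apply: contraNN => /eqP yu.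
    have := rest_ge0 u; rewrite /rest yu sub0r -opprD oppr_ge0 => r0.
    rewrite oppr_eq0; apply/eqP/le_anti; rewrite r0 addr_ge0 //.
      by rewrite mulr_ge0 ?ler0n.
    by rewrite mulr_ge0 ?ler0n.
  + by rewrite inE rest_b mul0r eqxx.
  + by apply/fintype.subsetPn; exists u0 => //; rewrite inE rest_u0 mul0r eqxx.
exists (realization_point xE, in_unit tau01); apply: bary_inj => u.
by apply: blendE; rewrite [bary _ u]/(rest u / d) mulrC divfK.
Qed.

(* [K] is the equator with two cones attached, over the vertex [b] and over the
   simplex [B]; a point of [K] is a convex combination of a point of the equator
   with [b] or with the barycenter of [B]. *)
Lemma suspension_equator :
  homeomorphic (suspension R (realization R equator)) (realization R K).
Proof.
apply: (@bij_compact_hausdorff _ _ (suspension_lift join)).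
- apply/suspension_compact/realization_compact => s t st.
  rewrite !inE => /and3P[tK bt Bt]; rewrite (dK st tK) /=; apply/andP; split.
    by apply: contra bt; exact: (fintype.subsetP st).
  by apply: contra Bt => Bs; exact: fintype.subset_trans Bs st.
- exact: realization_hausdorff.
- exact: suspension_lift_continuous.
have /choice[h hK] := join_surj.
exists (fun y => \pi_(suspension R (realization R equator)) (h y)).
  move=> q; have [p ->] : exists p,
      q = \pi_(suspension R (realization R equator)) p.
    by exists (repr q); rewrite reprK.
  rewrite suspension_lift_pi //; apply/suspension_piP/join_inj; exact: hK.
by move=> y; rewrite suspension_lift_pi.
Qed.

End SuspensionRealization.

End Realizations.

(** * Independence complexes *)

Section AddingEdges.
Variables (R : realType) (V : finType).
Implicit Types E A : {set {set V}}.

Lemma indep_complex_down_closed E : down_closed (indep_complex E).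
Proof.
move=> s t st; rewrite !inE => /forall_inP tE; apply/forall_inP => e eE.
by apply: contra (tE e eE) => es; exact: fintype.subset_trans es st.
Qed.

Lemma indep_complex_setU1 E sigma :
  indep_complex (sigma |: E) = faces_avoiding (indep_complex E) sigma.
Proof.
apply/setP => s; rewrite !inE; apply/forall_inP/andP.
  move=> sE; split; last by apply: sE; rewrite finset.setU11.
  by apply/forall_inP => e eE; apply: sE; rewrite inE eE orbT.
by move=> [/forall_inP sE ss] e; rewrite !inE => /orP[/eqP->|/sE].
Qed.

(** The link of [sigma] is a cone with apex [v]: if [s] is independent and contains [sigma], an edge
    [e] inside [v |: s] must contain [v], and then [f] lies in [s], a contradiction. *)
Lemma add_edge_equivalent E (sigma : {set V}) (v : V) :
  sigma != finset.set0 -> v \notin sigma ->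
  (forall e, e \in E -> v \in e ->
    exists2 f : {set V}, f \in E & f \subset (e :\ v) :|: sigma) ->
  homotopy_equivalent R (realization R (indep_complex E))
    (realization R (indep_complex (sigma |: E))).
Proof.
move=> sigma0 vsigma cone; rewrite indep_complex_setU1.
apply: (@cone_link_equivalent R V _ sigma v) => //.
  exact: indep_complex_down_closed.
move=> s; rewrite !inE => /forall_inP sE sigma_s; apply/forall_inP => e eE.
apply/negP => evs; have [ve|ve] := boolP (v \in e).
  have [f fE fsub] := cone e eE ve; case/negP: (sE f fE).
  apply: (fintype.subset_trans fsub); rewrite finset.subUset sigma_s andbT.
  by rewrite finset.subDset.
case/negP: (sE e eE); apply/fintype.subsetP => u ue.
have := fintype.subsetP evs u ue; rewrite !inE => /orP[/eqP uv|//].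
by rewrite -uv ue in ve.
Qed.

(** The edge [e] ranges over [E :|: A] but [f] is sought in [E], so the condition holds whichever
    part of [A] is already present, and the edges can be added one at a time. *)
Lemma add_edges_equivalent E A :
  (forall sigma, sigma \in A -> sigma != finset.set0 /\
    exists2 v : V, v \notin sigma &
      forall e, e \in E :|: A -> v \in e ->
      exists2 f : {set V}, f \in E & f \subset (e :\ v) :|: sigma) ->
  homotopy_equivalent R (realization R (indep_complex E))
    (realization R (indep_complex (E :|: A))).
Proof.
move=> cone.
suff main (s : seq {set V}) : {subset s <= A} ->
    homotopy_equivalent R (realization R (indep_complex E))
      (realization R (indep_complex (E :|: [set e in s]%SET))).
  have := main (enum A); rewrite finset.set_enum; apply.
  by move=> e; rewrite mem_enum.
elim: s => [_|sigma s IH sA].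
  rewrite finset.set_nil finset.setU0; apply: homeomorphic_homotopy_equivalent.
  by exists id, id; split=> // x.
have sA' : {subset s <= A} by move=> e es; apply: sA; rewrite inE es orbT.
apply: homotopy_equivalent_trans (IH sA') _.
rewrite finset.set_cons finset.setUCA.
have [sigma0 [v vsigma conev]] := cone sigma (sA sigma (mem_head _ _)).
apply: (@add_edge_equivalent _ sigma v) => // e eE ve.
have [|f fE fsub] := conev e _ ve; last by exists f => //; rewrite inE fE.
by move: eE; rewrite !inE => /orP[->//|/sA' ->]; rewrite orbT.
Qed.

End AddingEdges.

(** * Windows of a sequence *)

Section Windows.
Variable T : finType.

Definition window (k : nat) (w : seq T) (j : nat) : {set T} :=
  [set v in take k (drop j w)]%SET.

(** Distinct entries make a window an interval of positions, which turns inclusions between windows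
    into linear arithmetic. *)
Lemma mem_window k w j x :
  uniq w -> (x \in window k w j) = (x \in w) && (j <= index x w < j + k)%N.
Proof.
rewrite inE -{1 3 4 5}(cat_take_drop j w) cat_uniq => /and3P[_ /hasPn disj _].
have [xd|xd] := boolP (x \in drop j w); last first.
  rewrite (contraNF (@mem_take _ _ _ _) xd) mem_cat (negPf xd) orbF index_cat.
  case: ifP => //= xt; have : (index x (take j w) < j)%N.
    apply: leq_trans (_ : size (take j w) <= j)%N; first by rewrite index_mem.
    by rewrite size_take; case: ltnP.
  by rewrite ltnNge => /negPf->.
have jw : (j <= size w)%N.
  by rewrite leqNgt; apply/negP => /ltnW wj; rewrite drop_oversize in xd.
have xt : x \notin take j w := disj x xd.
rewrite mem_cat xd orbT /= index_cat (negPf xt) size_takel // leq_addr /=.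
by rewrite ltn_add2l in_take.
Qed.

Lemma mem_tight_path k w e :
  (e \in tight_path k w) =
  (e \in [seq window k w j | j <- iota 0 ((size w).+1 - k)]).
Proof.
apply/imsetP/mapP => [[j _ ->]|[j]]; last first.
  by rewrite mem_iota add0n /= => jw ->; exists (Ordinal jw).
by exists (val j) => //; rewrite mem_iota /= add0n.
Qed.

End Windows.

(** * Positions on the lengthened path *)

Section Lengthening.
Variables (R : realType) (k : nat) (V : finType) (H : {set {set V}}).
Variable a : seq V.
Hypotheses (k_ge2 : 2 <= k) (Hax : hypergraph_axiom H) (ua : uniq a).
Hypotheses (size_a : size a = 2 * k - 2) (aH : tight_path k a \subset H).

Local Notation W := (V + 'I_k.+1)%type.
Let w : seq W := lengthened_seq k a.

Let inlI : injective (@inl V 'I_k.+1). Proof. by move=> x y []. Qed.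
Let inrI : injective (@inr V 'I_k.+1). Proof. by move=> x y []. Qed.

Let size_left : size (take k.-1 a) = k.-1.
Proof. by rewrite size_takel // size_a; lia. Qed.

Let uniq_w : uniq w.
Proof.
have := ua; rewrite -{1}(cat_take_drop k.-1 a) cat_uniq => /and3P[u1 u2 u3].
rewrite /w /lengthened_seq !cat_uniq !map_inj_uniq // u1 u3.
rewrite -enumT fintype.enum_uniq /= andbT.
apply/andP; split; apply/hasPn => z; last first.
  by move=> /mapP[x _ ->]; apply/negP => /mapP[].
rewrite mem_cat => /orP[/mapP[i _ ->]|/mapP[x xa ->]]; apply/negP => /mapP[//].
by move=> y ya [xy]; move/hasPn: u2 => /(_ x xa); rewrite xy ya.
Qed.

Let size_w : size w = 3 * k - 1.
Proof.
rewrite /w /lengthened_seq !size_cat !size_map size_left size_drop size_a.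
by rewrite -enumT size_enum_ord; lia.
Qed.

Let Win (j : nat) : {set W} := window k w j.

(** The entry [inr i] has position [k.-1 + i] in [w]. *)
Let mem_Win_inr j (i : 'I_k.+1) : (inr i \in Win j) = (i <= j < k + i).
Proof.
rewrite mem_window //; have -> : inr i \in w.
  by rewrite /w /lengthened_seq !mem_cat (mem_map inrI) mem_enum /= orbT.
rewrite /w /lengthened_seq index_cat ifN; last by apply/negP => /mapP[].
rewrite size_map size_left index_cat (mem_map inrI) mem_enum inE index_map //.
by rewrite index_enum_ord /=; lia.
Qed.

(** Entries of the left half of [a] keep their position; those of the right half move up by
    [k.+1]. *)
Let mem_Win_inl j x : (inl x \in Win j) =
  (x \in a) && ((index x a < k.-1) && (j <= index x a < j + k) ||
                (k.-1 <= index x a) && (j <= index x a + k.+1 < j + k)).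
Proof.
rewrite mem_window //; have -> : (inl x \in w) = (x \in a).
  rewrite /w /lengthened_seq !mem_cat !(mem_map inlI).
  have -> : (inl x \in [seq inr i | i <- enum 'I_k.+1]) = false.
    by apply/negP => /mapP[].
  by rewrite /= -mem_cat cat_take_drop.
have [xa|//] := boolP (x \in a); rewrite /w /lengthened_seq index_cat.
rewrite (mem_map inlI) index_map // size_map size_left in_take //.
have idx : index x a = if index x a < k.-1 then index x (take k.-1 a)
                       else k.-1 + index x (drop k.-1 a).
  by rewrite -{1}(cat_take_drop k.-1 a) index_cat in_take // size_left.
move: idx; case: ltnP => lt -> /=; first by rewrite orbF.
rewrite index_cat ifN; last by apply/negP => /mapP[].
by rewrite index_map // size_map size_enum_ord; congr andb; lia.
Qed.

Let A (j : nat) : {set V} := window k a j.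

Let mem_A j x : (x \in A j) = (x \in a) && (j <= index x a < j + k).
Proof. exact: mem_window. Qed.

Let inlH : {set {set W}} := [set inl @: (e : {set V}) | e in H]%SET.

(** Only the indices [k.-1] and [k] give windows made of new vertices alone: $b_1, \ldots, b_k$ and
    $b_2, \ldots, b_{k+1}$. Smaller indices reach into the left half of [a], larger ones into the
    right half. *)
Let Wins (lo hi : nat) : {set {set W}} :=
  [set e in [seq Win j | j <- index_iota lo hi]]%SET.

Let WinsP lo hi e :
  reflect (exists2 j, lo <= j < hi & e = Win j) (e \in Wins lo hi).
Proof.
rewrite inE; apply: (iffP mapP) => -[j]; rewrite ?mem_index_iota.
  by exists j.
by exists j; rewrite // mem_index_iota.
Qed.

Let WinsU lo mi hi : lo <= mi <= hi -> Wins lo hi = Wins mi hi :|: Wins lo mi.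
Proof.
move=> lmh; apply/setP => e; rewrite finset.in_setU; apply/WinsP/orP.
  move=> [j jlh ->]; have [jm|jm] := leqP mi j.
    by left; apply/WinsP; exists j => //; lia.
  by right; apply/WinsP; exists j => //; lia.
by case=> /WinsP[j jlh ->]; exists j => //; lia.
Qed.

Let index_a x : x \in a -> index x a < 2 * k - 2.
Proof. by rewrite -size_a index_mem. Qed.

Let A_in_H j : j < k.-1 -> A j \in H.
Proof.
move=> jk; apply: (fintype.subsetP aH); rewrite mem_tight_path; apply: map_f.
by rewrite mem_iota size_a; lia.
Qed.

Let lengthening_edges :
  inlH :|: Wins 0 (2 * k) =
  lengthening k H a :|: [set inl @: A (val j) | j : 'I_k.-1]%SET.
Proof.
have tpW : tight_path k w = Wins 0 (2 * k).
  apply/setP => e; rewrite mem_tight_path inE size_w /index_iota.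
  by rewrite (_ : (3 * k - 1).+1 - k = 2 * k - 0) //; lia.
rewrite /lengthening tpW; apply/setP => e; rewrite !finset.in_setU.
have [eW|_] := boolP (e \in Wins 0 (2 * k)); first by rewrite !orbT.
rewrite !orbF; apply/imsetP/orP.
  move=> [f fH ->]; have [ft|ft] := boolP (f \in tight_path k a).
    right; move: ft; rewrite mem_tight_path => /mapP[j].
    rewrite mem_iota size_a => jk ->.
    have jk1 : j < k.-1 by lia.
    by apply/imsetP; exists (Ordinal jk1).
  by left; apply/imsetP; exists f; rewrite // inE ft.
case=> /imsetP[f]; first by rewrite inE => /andP[_ fH] ->; exists f.
by move=> _ ->; exists (A (val f)) => //; exact: A_in_H (ltn_ord f).
Qed.

(** * Exchanging edges of the lengthened hypergraph *)

Let inr_notin_inlH e (i : 'I_k.+1) : e \in inlH -> inr i \in e -> False.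
Proof. by move=> /imsetP[f _ ->] /imsetP[]. Qed.

Let add_short_windows :
  homotopy_equivalent R
    (realization R (indep_complex (lengthening k H a)))
    (realization R (indep_complex (inlH :|: Wins 0 (2 * k)))).
Proof.
rewrite lengthening_edges; apply: add_edges_equivalent => _ /imsetP[j _ ->].
have jk := ltn_ord j; split.
  have : A (val j) \in H by exact: A_in_H.
  move=> /(proj1 Hax) /card_gt1P[x [y [xA _ _]]].
  by apply/set0Pn; exists (inl x); exact: imset_f.
have j1k : j.+1 < k.+1 by lia.
(* The apex is $b_{j+2}$: the windows through it have indices from [j.+1] to [k + j], and the
   nearest windows on either side, [Win j] and [Win (k + j).+1], serve as witnesses. *)
exists (inr (Ordinal j1k)); first by apply/negP => /imsetP[].
move=> e; rewrite -lengthening_edges inE => /orP[eH|/WinsP[m mk ->]].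
  by move/(inr_notin_inlH eH).
rewrite mem_Win_inr /= => jm.
have in_long i : i < 2 * k -> Win i \in lengthening k H a.
  move=> ik; rewrite inE; apply/orP; right; rewrite mem_tight_path size_w.
  by apply: map_f; rewrite mem_iota; lia.
(* For [m <= k.-1] the window contains every new vertex before the apex, and [A j] supplies the old
   vertices of [Win j]. Otherwise it contains every new vertex after the apex, and the right-hand
   witness is covered in the same way. *)
have [mk1|mk1] := leqP m k.-1.
  exists (Win j); first by apply: in_long; lia.
  apply/fintype.subsetP => -[x|i];
    rewrite finset.in_setU finset.in_setD1 ?mem_Win_inl ?mem_Win_inr.
    rewrite (mem_imset _ _ inlI) mem_A.
    case xa: (x \in a) => //=; have := index_a xa; lia.
  rewrite (inj_eq inrI) -val_eqE /=; lia.
exists (Win (k + j).+1); first by apply: in_long; lia.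
apply/fintype.subsetP => -[x|i];
  rewrite finset.in_setU finset.in_setD1 ?mem_Win_inl ?mem_Win_inr.
  rewrite (mem_imset _ _ inlI) mem_A.
  case xa: (x \in a) => //=; have := index_a xa; lia.
rewrite (inj_eq inrI) -val_eqE /=; have := ltn_ord i; lia.
Qed.

Let drop_left_windows :
  homotopy_equivalent R
    (realization R (indep_complex (inlH :|: Wins k.-1 (2 * k))))
    (realization R (indep_complex (inlH :|: Wins 0 (2 * k)))).
Proof.
rewrite (@WinsU 0 k.-1) ?finset.setUA; last by lia.
apply: add_edges_equivalent => _ /WinsP[j jk ->].
split; first by apply/set0Pn; exists (inr ord0); rewrite mem_Win_inr /=; lia.
exists (inr ord_max); first by rewrite mem_Win_inr /=; lia.
move=> e; rewrite -finset.setUA finset.in_setU.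
move=> /orP[eH /(inr_notin_inlH eH) //|].
rewrite finset.in_setU => em ek.
have {em ek} [m mk ->] : exists2 m, k <= m < 2 * k & e = Win m.
  by case/orP: em ek => /WinsP[m mk ->]; rewrite mem_Win_inr /= => mk';
    exists m => //; lia.
(* If [m <= k + j], [Win j] and [Win m] together cover $b_1, \ldots, b_k$. Otherwise [Win m] extends
   far enough to the right that their old vertices cover [A j], an edge now that the short path is
   restored. *)
have [mj|mj] := leqP m (k + j).
  exists (Win k.-1).
    by rewrite finset.in_setU; apply/orP; right; apply/WinsP;
      exists k.-1 => //; lia.
  apply/fintype.subsetP => -[x|i];
    rewrite finset.in_setU finset.in_setD1 ?mem_Win_inl ?mem_Win_inr.
    case xa: (x \in a) => //=; have := index_a xa; lia.
  rewrite (inj_eq inrI) -val_eqE /=; have := ltn_ord i; lia.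
exists (inl @: A j).
  rewrite finset.in_setU; apply/orP; left; apply: imset_f; apply: A_in_H; lia.
apply/fintype.subsetP => _ /imsetP[x + ->].
rewrite mem_A finset.in_setU finset.in_setD1 !mem_Win_inl.
case xa: (x \in a) => //=; have := index_a xa; lia.
Qed.

Let drop_right_windows :
  homotopy_equivalent R
    (realization R (indep_complex (inlH :|: Wins k.-1 k.+1)))
    (realization R (indep_complex (inlH :|: Wins k.-1 (2 * k)))).
Proof.
rewrite (@WinsU k.-1 k.+1 (2 * k)); last by lia.
rewrite (finset.setUC (Wins k.+1 _)) finset.setUA.
apply: add_edges_equivalent => _ /WinsP[j jk ->].
split.
  by apply/set0Pn; exists (inr ord_max); rewrite mem_Win_inr /=; lia.
exists (inr ord0); first by rewrite mem_Win_inr /=; lia.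
move=> e; rewrite -finset.setUA finset.in_setU.
move=> /orP[eH /(inr_notin_inlH eH) //|].
rewrite finset.in_setU => em e0.
(* With the left windows gone this is the only edge through $b_1$. Every right window contains
   $b_{k+1}$, which replaces $b_1$ to give [Win k]. *)
have {em e0} -> : e = Win k.-1.
  by case/orP: em e0 => /WinsP[m mk ->]; rewrite mem_Win_inr /= => mk';
    congr Win; lia.
exists (Win k).
  by rewrite finset.in_setU; apply/orP; right; apply/WinsP; exists k => //; lia.
apply/fintype.subsetP => -[x|i];
  rewrite finset.in_setU finset.in_setD1 ?mem_Win_inl ?mem_Win_inr.
  case xa: (x \in a) => //=; have := index_a xa; lia.
rewrite (inj_eq inrI) -val_eqE /=; have := ltn_ord i; lia.
Qed.

(** Deleting a vertex is adding its singleton as an edge. The exchange of $b_1$ for $b_{k+1}$ again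
    turns [Win k.-1] into [Win k]. *)
Let drop_last_vertex :
  homotopy_equivalent R
    (realization R (indep_complex (inlH :|: Wins k.-1 k.+1)))
    (realization R (indep_complex
      ([set inr ord_max]%SET |: (inlH :|: Wins k.-1 k.+1)))).
Proof.
apply: (@add_edge_equivalent _ _ _ _ (inr ord0)).
- by apply/set0Pn; exists (inr ord_max); rewrite finset.in_set1.
- by rewrite finset.in_set1 (inj_eq inrI) -val_eqE /=; lia.
move=> e; rewrite finset.in_setU => /orP[eH /(inr_notin_inlH eH) //|].
case/WinsP=> m mk ->; rewrite mem_Win_inr /= => mk'.
have {mk mk'} -> : m = k.-1 by lia.
exists (Win k).
  by rewrite finset.in_setU; apply/orP; right; apply/WinsP; exists k => //; lia.
apply/fintype.subsetP => -[x|i];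
  rewrite finset.in_setU finset.in_setD1 finset.in_set1 ?mem_Win_inl
    ?mem_Win_inr.
  case xa: (x \in a) => //=; have := index_a xa; lia.
rewrite !(inj_eq inrI) -!val_eqE /=; have := ltn_ord i; lia.
Qed.

(* The join of [indep_complex H] with the boundary of the simplex on
   [b_1, ..., b_j]; the vertex [b_(i+1)] is [inr i]. *)
Let JoinSphere (j : nat) : {set {set W}} :=
  [set s : {set W} | [&& inl @^-1: s \in indep_complex H,
    [forall i : 'I_k.+1, (inr i \in s) ==> (i < j)]
    & ~~ [forall i : 'I_k.+1, (i < j) ==> (inr i \in s)]]]%SET.

Let JoinSphereP (j : nat) (s : {set W}) :
  reflect [/\ inl @^-1: s \in indep_complex H,
             forall i : 'I_k.+1, inr i \in s -> i < j
           & exists2 i : 'I_k.+1, i < j & inr i \notin s]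
          (s \in JoinSphere j).
Proof.
rewrite [s \in _]finset.in_set; apply: (iffP and3P).
  move=> [sH /forallP sj /forallPn[i]]; rewrite negb_imply => /andP[ij si].
  by split=> //; [move=> l; apply/implyP | exists i].
move=> [sH sj [i ij si]]; split=> //.
  by apply/forallP => l; apply/implyP/sj.
by apply/forallPn; exists i; rewrite negb_imply ij.
Qed.

Let JoinSphere_down_closed j : down_closed (JoinSphere j).
Proof.
move=> s t st /JoinSphereP[tH tj [i ij ti]]; apply/JoinSphereP; split.
- apply: indep_complex_down_closed tH; exact: finset.preimsetS.
- by move=> l /(fintype.subsetP st); exact: tj.
- by exists i => //; apply: contra ti; exact: (fintype.subsetP st).
Qed.

(** Once $b_{k+1}$ is excluded, [Win k] imposes nothing, and [Win k.-1] forbids exactly the full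
    simplex on $b_1, \ldots, b_k$. *)
Let indep_JoinSphere :
  indep_complex ([set inr ord_max]%SET |: (inlH :|: Wins k.-1 k.+1)) =
  JoinSphere k.
Proof.
apply/setP => s; apply/idP/JoinSphereP.
  rewrite finset.in_set => /forall_inP sE; split.
  - rewrite finset.in_set; apply/forall_inP => e eH.
    rewrite -sub_imset_pre; apply: sE; rewrite !finset.in_setU.
    by rewrite (_ : inl @: e \in inlH) ?orbT //; exact: imset_f.
  - move=> i si; rewrite ltn_neqAle -ltnS ltn_ord andbT.
    have : ~~ ([set inr ord_max]%SET \subset s).
      by apply: sE; rewrite finset.in_setU finset.in_set1 eqxx.
    rewrite finset.sub1set; apply: contraNneq => ik.
    by rewrite (_ : ord_max = i) //; exact: val_inj.
  - have : ~~ (Win k.-1 \subset s).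
      apply: sE; rewrite !finset.in_setU; apply/orP; right; apply/orP; right.
      by apply/WinsP; exists k.-1 => //; lia.
    case/fintype.subsetPn => -[x|i].
      rewrite mem_Win_inl; case xa: (x \in a) => //=; have := index_a xa; lia.
    by rewrite mem_Win_inr => ik si; exists i => //; lia.
move=> [sH sk [i ik si]]; rewrite finset.in_set; apply/forall_inP => e.
rewrite finset.in_setU finset.in_set1 finset.in_setU.
case/or3P => [/eqP->|/imsetP[f fH ->]|/WinsP[m mk ->]].
- by rewrite finset.sub1set; apply/negP => /sk; rewrite ltnn.
- rewrite sub_imset_pre; move: sH; rewrite finset.in_set => /forall_inP; exact.
- have [->|->] : m = k.-1 \/ m = k by lia.
    by apply/fintype.subsetPn; exists (inr i) => //; rewrite mem_Win_inr; lia.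
  apply/fintype.subsetPn; exists (inr ord_max).
    by rewrite mem_Win_inr /=; lia.
  by apply/negP => /sk; rewrite ltnn.
Qed.

Let lengthening_JoinSphere :
  homotopy_equivalent R
    (realization R (indep_complex (lengthening k H a)))
    (realization R (JoinSphere k)).
Proof.
rewrite -indep_JoinSphere.
apply: homotopy_equivalent_trans add_short_windows _.
(* The two removals were established as additions of edges and are read backwards. *)
apply: homotopy_equivalent_trans (homotopy_equivalent_sym drop_left_windows) _.
apply: homotopy_equivalent_trans (homotopy_equivalent_sym drop_right_windows) _.
exact: drop_last_vertex.
Qed.

(** * Iterated suspensions as joins with simplex boundaries *)

Let vertex_in_H (u : V) : [set u]%SET \in indep_complex H.
Proof.
rewrite finset.in_set; apply/forall_inP => e eH; apply/negP => /subset_leq_card.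
by rewrite cards1 leqNgt (proj1 Hax).
Qed.

Let vertex0 : V. Proof. by case: a size_a => [|u _] //=; lia. Qed.

(** The poles are the vertex $b_{j+1}$ and the simplex on $b_1, \ldots, b_j$; a face avoiding the
    first and not containing the second is a face of the smaller join. *)
Let equator_JoinSphere j (jk : j < k.+1) :
  equator (JoinSphere j.+1) (inr (Ordinal jk))
    [set inr i | i : 'I_k.+1 & i < j]%SET = JoinSphere j.
Proof.
apply/setP => s; rewrite [LHS]finset.in_set; apply/and3P/JoinSphereP.
  move=> [/JoinSphereP[sH sj _] sb /fintype.subsetPn[_ /imsetP[i + ->] si]].
  rewrite finset.in_set => ij; split=> //; last by exists i.
  move=> l sl; have := sj l sl; rewrite ltnS leq_eqVlt => /orP[/eqP lj|//].
  by rewrite (_ : Ordinal jk = l) ?sl // in sb; exact: val_inj.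
move=> [sH sj [i ij si]]; split.
- apply/JoinSphereP; split=> //; first by move=> l /sj /ltnW.
  by exists i => //; exact: ltnW.
- by apply/negP => /sj; rewrite /= ltnn.
- by apply/fintype.subsetPn; exists (inr i) => //; apply: imset_f;
    rewrite finset.in_set.
Qed.

Let suspension_JoinSphere j : 0 < j < k.+1 ->
  homeomorphic (suspension R (realization R (JoinSphere j)))
    (realization R (JoinSphere j.+1)).
Proof.
move=> /andP[j0 jk]; rewrite -(equator_JoinSphere jk).
apply: suspension_equator.
- exact: JoinSphere_down_closed.
- by apply/set0Pn; exists (inr ord0); apply: imset_f; rewrite finset.in_set.
- by apply/negP => /imsetP[i]; rewrite finset.in_set => ij [ji];
    rewrite -ji /= ltnn in ij.
(* The two poles together are all of $b_1, \ldots, b_{j+1}$, and a face must omit one of these. *)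
- apply/negP => /JoinSphereP[_ _ [i]]; rewrite ltnS leq_eqVlt finset.in_setU1.
  move=> /orP[/eqP ij|ij]; rewrite negb_or.
    by rewrite (_ : i = Ordinal jk) ?eqxx //; exact: val_inj.
  by rewrite imset_f ?andbF // finset.in_set.
- move=> s; rewrite equator_JoinSphere => /JoinSphereP[sH sj [i ij si]].
  apply/JoinSphereP; split.
  + by rewrite (_ : _ @^-1: _ = inl @^-1: s) //; apply/setP => x; rewrite !inE.
  + by move=> l; rewrite finset.in_setU1 => /orP[/eqP[->]//|/sj/ltnW].
  + exists i; first exact: ltnW.
    rewrite finset.in_setU1 negb_or si andbT (inj_eq inrI) -val_eqE /=.
    by rewrite ltn_eqF.
- move=> s; rewrite equator_JoinSphere => /JoinSphereP[sH sj [i ij si]].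
  apply/JoinSphereP; split.
  + rewrite (_ : _ @^-1: _ = inl @^-1: s) //; apply/setP => x; rewrite !inE.
    by case: imsetP => // -[].
  + move=> l; rewrite finset.in_setU => /orP[/imsetP[m + [->]]|/sj/ltnW//].
    by rewrite finset.in_set => /ltnW.
  + exists (Ordinal jk); rewrite //= finset.in_setU negb_or; apply/andP; split.
      by apply/negP => /imsetP[m + [jm]]; rewrite finset.in_set -jm /= ltnn.
    by apply/negP => /sj; rewrite /= ltnn.
(* A vertex of [V] is a point of the equator, because edges of [H] have at least two elements. *)
- apply: (@vertex_point _ _ _ (inl vertex0)); rewrite equator_JoinSphere.
  apply/JoinSphereP; split.
  + rewrite (_ : _ @^-1: _ = [set vertex0]%SET) //; apply/setP => x.
    by rewrite !inE (inj_eq inlI).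
  + by move=> l; rewrite finset.in_set1.
  + by exists ord0; rewrite // finset.in_set1.
Qed.

(** The boundary of a single vertex has only the empty face, so this join is [indep_complex H] on a
    larger vertex set; the homeomorphism extends coordinates by 0. *)
Let JoinSphere1 :
  homeomorphic (realization R (indep_complex H)) (realization R (JoinSphere 1)).
Proof.
have no_inr (y : realization R (JoinSphere 1)) i : bary y (inr i) = 0%R.
  have /JoinSphereP[_ s1 [l l0 sl]] := bary_supp y.
  apply/eqP; rewrite -[_ == _]negbK; apply/negP => yi.
  have si : inr i \in supp (bary y) by rewrite finset.in_set.
  have li : l = i by apply: val_inj; have := s1 i si; move: l0 => /=; lia.
  by rewrite li si in sl.
pose ext (x : realization R (indep_complex H)) (z : W) : R :=
  if z is inl u then bary x u else 0%R.
have ext_real x : realization_set (JoinSphere 1) (ext x).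
  split=> [[u|i]||] //=; first exact: bary_ge0.
    by rewrite big_sumType /= bary_sum big1 ?addr0.
  apply/JoinSphereP; split.
  - rewrite (_ : _ @^-1: _ = supp (bary x)) ?bary_supp //.
    by apply/setP => u; rewrite !inE.
  - by move=> i; rewrite finset.in_set /= eqxx.
  - by exists ord0; rewrite // finset.in_set /= eqxx.
have res_real (y : realization R (JoinSphere 1)) :
    realization_set (indep_complex H) (fun u => bary y (inl u)).
  split=> [u||]; first exact: bary_ge0.
    rewrite -(bary_sum y) big_sumType /= [X in (_ + X)%R]big1 ?addr0 //.
  have /JoinSphereP[+ _ _] := bary_supp y.
  by rewrite (_ : _ @^-1: _ = [set u | bary y (inl u) != 0%R]%SET) //;
    apply/setP => u; rewrite !inE.
exists (fun x => realization_point (ext_real x)).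
exists (fun y => realization_point (res_real y)); split.
- apply: realization_continuous => -[u|i].
    exact: (@bary_continuous R V (indep_complex H) u).
  exact: (@cst_continuous (realization R (indep_complex H)) R 0%R).
- apply: realization_continuous => u.
  exact: (@bary_continuous R W (JoinSphere 1) (inl u)).
- by move=> x; apply: bary_inj.
- by move=> y; apply: bary_inj => -[u|i] //; exact/esym/no_inr.
Qed.

Let iter_suspension_JoinSphere m : m < k.+1 ->
  homeomorphic (iter_suspension R m (realization R (indep_complex H)))
    (realization R (JoinSphere m.+1)).
Proof.
elim: m => [_|m IH mk]; first exact: JoinSphere1.
apply: homeomorphic_trans (suspension_JoinSphere _); last by rewrite /=; lia.
by apply: suspension_homeomorphic; apply: IH; lia.
Qed.

Lemma lengthening_iter_suspension :
  homotopy_equivalent R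
    (realization R (indep_complex (lengthening k H a)))
    (iter_suspension R k.-1 (realization R (indep_complex H))).
Proof.
apply: homotopy_equivalent_trans lengthening_JoinSphere _.
apply/homeomorphic_homotopy_equivalent/homeomorphic_sym.
(* The joins start at index 1, so [k.-1] suspensions reach index [k]. *)
have := @iter_suspension_JoinSphere k.-1; rewrite prednK; last by lia.
by apply; lia.
Qed.

End Lengthening.

Unset Implicit Arguments.

Theorem theorem4p3 (R : realType) (k : nat) (V : finType) (H : {set {set V}})
    (a : (2 * k - 2).-tuple V) :
  (2 <= k)%N ->
  hypergraph_axiom H ->
  uniq a ->
  tight_path k a \subset H ->
  homotopy_equivalent R
    (realization R (indep_complex (lengthening k H a)))
    (iter_suspension R k.-1 (realization R (indep_complex H))).
Proof.
move=> k2 Hax ua aH.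
by apply: lengthening_iter_suspension; rewrite ?size_tuple.
Qed.
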